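(* Let $M\ge1$, let $\mathcal G=(S,E)$ be a path-complete graph on $\langle M\rangle$ satisfying the standing assumption, and let $T\ge1$ be an integer. Let $\mathcal D$ be the template of dual linear copositive norms and $\mathcal L$ the set of all $M$-tuples of nonnegative matrices. Then $$\mathcal G\le_{\mathcal D,\mathcal L}\mathcal G^{\oplus T}\qquad\text{and}\qquad \mathcal G\le_{\mathcal D,\mathcal L}\mathcal G_{\max}.$$
   Context: Graphs. $\langle M\rangle:=\{1,\dots,M\}$. A graph on $\langle M\rangle$ is a pair $\mathcal G=(S,E)$ with $S$ a finite nonempty set of nodes and $E\subseteq S\times S\times\langle M\rangle$ a set of directed labeled edges. $\mathcal G$ is path-complete if for every $K\ge1$ and every $(j_1,\dots,j_K)\in\langle M\rangle^K$ there are nodes $a_1,\dots,a_{K+1}$ with $(a_k,a_{k+1},j_k)\in E$ for $1\le k\le K$. Standing assumption on $\mathcal G$: $\mathcal G$ has one strongly connected component (it is strongly connected), and removing any edge from $\mathcal G$ destroys path-completeness. (The lifted graphs are not required to satisfy this.) Dual copositive norms. For $v\in\mathbb R^n_{>0}$, the dual linear copositive norm induced by $v$ is $g_v^\star:\mathbb R^n_{\ge0}\to\mathbb R$, $g_v^\star(x)=\max_i\{x_i/v_i\}$. $\mathcal D$ is the set of all such functions ($n\ge1$, $v\in\mathbb R^n_{>0}$). A nonnegative matrix is an $n\times n$ matrix with entries in $\mathbb R_{\ge0}$; $\mathcal L$ is the set of all $M$-tuples $(A_1,\dots,A_M)$ of nonnegative matrices of a common size $n\times n$, for all $n\ge1$.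 Order relation. For path-complete graphs $\mathcal G=(S,E)$, $\widetilde{\mathcal G}=(\widetilde S,\widetilde E)$ on $\langle M\rangle$, $\mathcal G\le_{\mathcal D,\mathcal L}\widetilde{\mathcal G}$ means: for every $n$ and every $(A_1,\dots,A_M)\in\mathcal L$ of size $n\times n$, if there are functions $V_s\in\mathcal D$ on $\mathbb R^n_{\ge0}$ ($s\in S$) with $V_b(A_ix)\le V_a(x)$ for all $(a,b,i)\in E$ and all $x\in\mathbb R^n_{\ge0}$, then there are functions $W_s\in\mathcal D$ on $\mathbb R^n_{\ge0}$ ($s\in\widetilde S$) with $W_b(A_ix)\le W_a(x)$ for all $(a,b,i)\in\widetilde E$ and all $x\in\mathbb R^n_{\ge0}$. The relation includes that both graphs are path-complete. Lifts of $\mathcal G=(S,E)$. - $T$-sum lift $\mathcal G^{\oplus T}$: nodes are the multisets of cardinality $T$ with elements in $S$; the edges are $(\{a_1,\dots,a_T\},\{b_1,\dots,b_T\},i)$ for each label $i$ and each multiset of $T$ edges $\{(a_1,b_1,i),\dots,(a_T,b_T,i)\}$ of $E$ (all with label $i$, repetitions allowed). - Max lift $\mathcal G_{\max}$: nodes are the nonempty subsets of $S$; $(A,B,i)$ is an edge iff for all $b\in B$ there is $a\in A$ with $(a,b,i)\in E$. *)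

(* Defs.v *)
From HB Require Import structures.
From mathcomp Require Import all_boot all_order all_algebra.
From mathcomp Require Import finmap multiset reals.

Set Implicit Arguments.
Unset Strict Implicit.
Unset Printing Implicit Defensive.

Import Order.TTheory GRing.Theory Num.Theory.

Local Open Scope fset_scope.
Local Open Scope mset_scope.
Local Open Scope ring_scope.

(* The labels 1, ..., M are represented by 'I_M. *)
Record graph (M : nat) := Graph {
  node : finType;
  node_gt0 : (0 < #|node|)%N;
  edges : {set node * node * 'I_M}
}.

Section Graphs.
Variable M : nat.
Implicit Type G : graph M.

Definition path_complete G : Prop :=
  forall (K : nat) (j : 'I_K -> 'I_M), (0 < K)%N ->
    exists a : 'I_K.+1 -> node G,
      forall k : 'I_K,
        (a (widen_ord (leqnSn K) k), a (lift ord0 k), j k) \in edges G.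

Definition strongly_connected G : Prop :=
  forall a b : node G,
    connect (fun c d : node G => [exists i : 'I_M, (c, d, i) \in edges G]) a b.

Definition remove_edge G (e : node G * node G * 'I_M) : graph M :=
  Graph (node_gt0 G) (edges G :\ e).

Definition edge_minimal G : Prop :=
  forall e, e \in edges G -> ~ path_complete (remove_edge e).

End Graphs.

Definition multisets (S : finType) (T : nat) : {fset {mset S}} :=
  [fset seq_mset (val t) | t in {: T.-tuple S}].

Lemma in_multisets (S : finType) (T : nat) (A : {mset S}) :
  (A \in multisets S T) = (size A == T).
Proof.
apply/imfsetP/eqP => [[t _ ->]|sA].
  by rewrite (perm_size (perm_eq_seq_mset _)) size_tuple.
by exists (tcast sA (in_tuple A)); rewrite //= val_tcast /= seq_mset_id.
Qed.

Section Lifts.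
Variables (M : nat) (G : graph M).

Lemma sum_lift_gt0 (T : nat) : (0 < #|{: multisets (node G) T}|)%N.
Proof.
have /card_gt0P[s _] := node_gt0 G.
have sT : seq_mset (nseq_tuple T s) \in multisets (node G) T.
  by apply/imfsetP; exists (nseq_tuple T s).
by apply/card_gt0P; exists [` sT].
Qed.

(* As edges G is a set of triples, a multiset of T edges labelled i is enumerated by
   the T-tuples a and b of its sources and targets. *)
Definition sum_lift (T : nat) : graph M :=
  Graph (sum_lift_gt0 T)
    [set e : multisets (node G) T * multisets (node G) T * 'I_M |
      [exists a : T.-tuple (node G), exists b : T.-tuple (node G),
        [&& val e.1.1 == seq_mset (val a),
            val e.1.2 == seq_mset (val b)
          & [forall k, (tnth a k, tnth b k, e.2) \in edges G]]]].

Lemma max_lift_gt0 : (0 < #|{: {A : {set node G} | A != set0}}|)%N.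
Proof.
have /card_gt0P[s _] := node_gt0 G.
have s0 : [set s]%SET != set0 by apply/set0Pn; exists s; rewrite inE.
by apply/card_gt0P; exists (exist _ [set s]%SET s0).
Qed.

Definition max_lift : graph M :=
  Graph max_lift_gt0
    [set e : {A : {set node G} | A != set0} * {A : {set node G} | A != set0}
             * 'I_M |
      [forall b in val e.1.2, exists a in val e.1.1,
        (a, b, e.2) \in edges G]].

End Lifts.

Section Order.
Variables (R : realType) (M : nat).

Definition nonneg_vec (n : nat) (x : 'cV[R]_n) : Prop :=
  forall k, 0 <= x k 0.

(* Dimensions n >= 1 are written n.+1. Functions on the nonnegative orthant are
   total functions on 'cV[R]_n.+1 of which only the values at nonnegative
   vectors are ever used. *)
Definition template := forall n : nat, ('cV[R]_n.+1 -> R) -> Prop.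
Definition matrix_family := forall n : nat, ('I_M -> 'M[R]_n.+1) -> Prop.

Definition admissible (D : template) (G : graph M) (n : nat)
    (A : 'I_M -> 'M[R]_n.+1) : Prop :=
  exists V : node G -> 'cV[R]_n.+1 -> R,
    (forall s, D n (V s)) /\
    forall (a b : node G) (i : 'I_M), (a, b, i) \in edges G ->
      forall x, nonneg_vec x -> V b (A i *m x) <= V a x.

Definition graph_le (D : template) (L : matrix_family) (G G' : graph M) : Prop :=
  [/\ path_complete G, path_complete G' &
      forall (n : nat) (A : 'I_M -> 'M[R]_n.+1), L n A ->
        admissible D G A -> admissible D G' A].

(* The maximum is seeded with the ratio at index 0, so it is the maximum of the
   ratios and of nothing else. *)
Definition dual_norm (n : nat) (v x : 'cV[R]_n.+1) : R :=
  \big[Num.max/(x ord0 0 / v ord0 0)]_(k < n.+1) (x k 0 / v k 0).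

Definition dual_copositive : template := fun n V =>
  exists2 v : 'cV[R]_n.+1, (forall k, 0 < v k 0) &
    forall x, nonneg_vec x -> V x = dual_norm v x.

Definition nonneg_tuples : matrix_family := fun n A =>
  forall i j k, 0 <= A i j k.

End Order.

Arguments dual_copositive R n V : clear implicits.
Arguments nonneg_tuples R M n A : clear implicits.

(* Main.v *)
(* The dual linear copositive norm g_v is at most c at x iff x <= c v entrywise,
   so for a nonnegative matrix A the inequality g_w(A x) <= g_v(x) on the
   orthant just says A v <= w. Hence a graph is admissible iff its nodes carry
   positive vectors v_s with A_i v_a <= v_b along every edge (a, b, i). Such
   vectors pass to the T-sum lift by summing over a multiset of nodes, and to
   the max lift by taking entrywise minima over a set of nodes. Both lifts are
   path-complete because G maps into them, by constant multisets and by
   singletons respectively. *)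
Require Import Defs.
From mathcomp Require Import all_boot all_order all_algebra reals.
From mathcomp Require Import finmap multiset.

Set Implicit Arguments.
Unset Strict Implicit.
Unset Printing Implicit Defensive.

Import Order.TTheory GRing.Theory Num.Theory.
Local Open Scope fset_scope.
Local Open Scope mset_scope.
Local Open Scope ring_scope.

Section PathCompleteness.
Variable M : nat.
Implicit Type G : graph M.

Lemma path_complete_map G G' (f : node G -> node G') :
  (forall a b i, (a, b, i) \in edges G -> (f a, f b, i) \in edges G') ->
  path_complete G -> path_complete G'.
Proof.
move=> fE pcG K j K_gt0; have [a aE] := pcG K j K_gt0.
by exists (f \o a) => k; apply/fE/aE.
Qed.

Lemma path_complete_sum_lift G T : path_complete G -> path_complete (sum_lift G T).
Proof.
have nseqP s : seq_mset (nseq_tuple T s) \in multisets (node G) T.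
  by apply/imfsetP; exists (nseq_tuple T s).
apply: (@path_complete_map _ (sum_lift G T) (fun s => [` nseqP s])).
move=> a b i abi; rewrite inE; apply/existsP; exists (nseq_tuple T a).
apply/existsP; exists (nseq_tuple T b); rewrite !eqxx /=.
by apply/forallP => k; rewrite !(tnth_nth a) /= !nth_nseq ltn_ord.
Qed.

Lemma path_complete_max_lift G : path_complete G -> path_complete (max_lift G).
Proof.
have set1_neq0 s : [set s] != set0 :> {set node G} by apply/set0Pn; exists s; rewrite inE.
apply: (@path_complete_map _ (max_lift G) (fun s => exist _ [set s] (set1_neq0 s))).
move=> a b i abi; rewrite inE; apply/forall_inP => _ /set1P ->.
by apply/exists_inP; exists a; rewrite ?inE.
Qed.

End PathCompleteness.

Section DualNorm.
Variable R : realType.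

Lemma dual_norm_leP n (v x : 'cV[R]_n.+1) (c : R) : (forall k, 0 < v k 0) ->
  dual_norm v x <= c <-> forall k, x k 0 <= c * v k 0.
Proof.
move=> v_gt0; split=> [xc k|xc].
  by rewrite -ler_pdivrMr //; apply: le_trans xc; apply: le_bigmax.
by apply: bigmax_le => [|k _]; rewrite ler_pdivrMr.
Qed.

Lemma le_mulmx_col n (A : 'M[R]_n) (x y : 'cV[R]_n) :
  (forall j k, 0 <= A j k) -> (forall k, x k 0 <= y k 0) ->
  forall k, (A *m x) k 0 <= (A *m y) k 0.
Proof.
by move=> A_ge0 xy k; rewrite !mxE ler_sum // => j _; rewrite ler_wpM2l.
Qed.

(** Forward, test the inequality at [x = v], where [dual_norm v v <= 1]. Backward, put
    [c = dual_norm v x]: then [x <= c v], so monotonicity of [A] gives [A x <= c (A v) <= c w]. *)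
Lemma dual_norm_mulmx_leP n (A : 'M[R]_n.+1) (v w : 'cV[R]_n.+1) :
  (forall j k, 0 <= A j k) -> (forall k, 0 < v k 0) -> (forall k, 0 < w k 0) ->
  (forall x, nonneg_vec x -> dual_norm w (A *m x) <= dual_norm v x) <->
  (forall k, (A *m v) k 0 <= w k 0).
Proof.
move=> A_ge0 v_gt0 w_gt0; split=> [le_wv k|Avw x x_ge0].
  rewrite -[leRHS]mul1r; move: k; apply/dual_norm_leP => //.
  apply: le_trans (le_wv v _) _ => [k|]; first exact: ltW.
  by apply/dual_norm_leP => // k; rewrite mul1r.
have xv : forall k, x k 0 <= dual_norm v x * v k 0 by apply/dual_norm_leP.
(* The sign of [c] is needed to scale [A v <= w]; coordinate 0 gives it, as [0 <= x_0 <= c v_0] with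
   [v_0 > 0]. *)
have c_ge0 : 0 <= dual_norm v x.
  by rewrite -(pmulr_lge0 _ (v_gt0 0)); apply: le_trans (xv 0).
apply/dual_norm_leP => // k.
have xvZ l : x l 0 <= (dual_norm v x *: v) l 0 by rewrite mxE.
apply: le_trans (le_mulmx_col A_ge0 xvZ k) _.
by rewrite -scalemxAr mxE ler_wpM2l.
Qed.

End DualNorm.

Section Admissibility.
Variables (R : realType) (M n : nat) (A : 'I_M -> 'M[R]_n.+1).
Hypothesis A_ge0 : nonneg_tuples R M n A.
Implicit Type G : graph M.

Lemma admissible_dual_copositiveP G :
  admissible (dual_copositive R) G A <->
  exists2 v : node G -> 'cV[R]_n.+1, (forall s k, 0 < v s k 0) &
    forall a b i, (a, b, i) \in edges G -> forall k, (A i *m v a) k 0 <= v b k 0.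
Proof.
split=> [[V [/fin_all_exists2[v v_gt0 VE] le_V]]|[v v_gt0 le_v]].
  exists v => // a b i abi.
  apply/dual_norm_mulmx_leP => // x x_ge0.
  (* [V b] is a dual norm only on the orthant, so [A i *m x] must be shown nonnegative. *)
  rewrite -!VE //; first exact: le_V.
  by move=> k; rewrite mxE sumr_ge0 // => j _; rewrite mulr_ge0 ?A_ge0.
exists (fun s => dual_norm (v s)); split=> [s|a b i abi]; first by exists (v s).
by apply/dual_norm_mulmx_leP => //; apply: le_v.
Qed.

Lemma admissible_sum_lift G T : (0 < T)%N ->
  admissible (dual_copositive R) G A ->
  admissible (dual_copositive R) (sum_lift G T) A.
Proof.
move=> T_gt0 /admissible_dual_copositiveP[v v_gt0 le_v].
apply/admissible_dual_copositiveP.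
exists (fun B : node (sum_lift G T) => \sum_(s <- (val B : {mset node G})) v s).
  move=> B k; rewrite summxE.
  have: size (val B : {mset node G}) = T by apply/eqP; rewrite -in_multisets; apply: valP.
  (* An empty sum would be the zero vector; [T > 0] provides one strictly positive summand. *)
  case: (enum_mset (val B)) => [T0|s r _]; first by rewrite -T0 in T_gt0.
  by rewrite big_cons ltr_pwDl // sumr_ge0 // => t _; apply: ltW.
move=> B C i; rewrite inE => /existsP[a /existsP[b]] /and3P[/eqP/= -> /eqP/= ->].
move=> /forallP abE k.
(* Summing along [a] and [b] instead pairs each source with its target, so the bound follows edge by
   edge. *)
rewrite !(perm_big _ (perm_eq_seq_mset _)) /= !big_tuple.
by rewrite mulmx_sumr !summxE ler_sum // => l _; apply: le_v.
Qed.

(** At coordinate [k] the minimum over [C] is attained at some [b], and the edge condition supplies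
    [a] in [B] with [(a, b, i)] an edge; hence [A_i w_B <= A_i v_a <= v_b], read at [k]. *)
Lemma admissible_max_lift G :
  admissible (dual_copositive R) G A ->
  admissible (dual_copositive R) (max_lift G) A.
Proof.
move=> /admissible_dual_copositiveP[v v_gt0 le_v].
apply/admissible_dual_copositiveP.
have minP (B : node (max_lift G)) : exists w : 'cV[R]_n.+1,
    (forall s, s \in val B -> forall k, w k 0 <= v s k 0) /\
    (forall k, exists2 s, s \in val B & w k 0 = v s k 0).
  have /set0Pn[s0 s0B] := valP B.
  (* The minimizing node may vary with [k]. *)
  exists (\col_k v [arg min_(s < s0 in val B) v s k 0]%O k 0).
  split=> [s sB k|k]; rewrite mxE; case: arg_minP => // t tB t_min.
    exact: t_min.
  by exists t.
have [w wP] := fin_all_exists minP.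
exists w => [B k|B C i].
  by have [_ /(_ k)[s _ ->]] := wP B.
rewrite inE => /forall_inP BCE k.
have [_ /(_ k)[b bC ->]] := wP C.
have /exists_inP[a aB abi] := BCE b bC.
apply: le_trans (le_v a b i abi k).
by apply: le_mulmx_col => //; have [/(_ a aB)] := wP B.
Qed.

End Admissibility.

Theorem theorem5 (R : realType) (M : nat) (hM : (1 <= M)%N) (G : graph M)
    (hpc : path_complete G) (hsc : strongly_connected G)
    (hmin : edge_minimal G) (T : nat) (hT : (1 <= T)%N) :
  graph_le (dual_copositive R) (nonneg_tuples R M) G (sum_lift G T) /\
  graph_le (dual_copositive R) (nonneg_tuples R M) G (max_lift G).
Proof.
split; split=> //.
- exact: path_complete_sum_lift.
- by move=> n A A_ge0; apply: admissible_sum_lift.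
- exact: path_complete_max_lift.
- by move=> n A A_ge0; apply: admissible_max_lift.
Qed.
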